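(* For all integers $n,m\geq 0$ and any indeterminate $y$, \begin{align*} \sum_{k=0}^{n}\binom{n}{k}L_{m+k,m}(y+1)^{n-k} &= \sum_{k=0}^{n}\binom{n}{k}(m+k+1)^{m+k-1}y^{n-k},\\ \sum_{k=0}^{n}\binom{n}{k}L_{m+k,m}\,B_{n-k+1}(y) &= y\sum_{k=0}^{n}\binom{n}{k}(m+k+1)^{m+k-1}B_{n-k}(y),\\ \sum_{k=0}^{n}\binom{n}{k}\binom{y+n-k}{n-k}L_{m+k,m} &= \sum_{k=0}^{n}\binom{n}{k}\binom{y}{n-k}(m+k+1)^{m+k-1}. \end{align*}
   Context: A labeled forest on a finite set $S$ is a set of rooted trees whose vertex sets partition $S$; a singleton tree is a tree with exactly one vertex. For $0\le k\le n$, $L_{n,k}$ is the number of labeled forests on $[n+1]=\{1,\dots,n+1\}$ in which $\{k+1\}$ is a singleton tree and no $i>k+1$ forms a singleton tree. $B_k(y)=\sum_{j=0}^k S(k,j)y^j$ is the $k$-th Bell (Touchard) polynomial, $S(k,j)$ being Stirling numbers of the second kind. Binomial coefficients in $y$ are polynomials in $y$. $1^{-1}=1$. *)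

(* Defs.v *)
From HB Require Import structures.
From mathcomp Require Import all_boot all_order all_algebra.

Set Implicit Arguments.
Unset Strict Implicit.
Unset Printing Implicit Defensive.

Import GRing.Theory.
Local Open Scope ring_scope.

Section Forests.

Variable T : finType.
Implicit Types (V S : {set T}) (E : {set {set T}}).

Definition adj E : rel T := [rel x y | [set x; y] \in E].

Definition is_graph V E : bool :=
  [forall e in E, (e \subset V) && (#|e| == 2)].

Definition connected V E : bool :=
  [forall x in V, forall y in V, connect (adj E) x y].

(* [ucycle] also holds of the sequences of length at most 2 that go back and
   forth along an edge, so the simple cycles of a graph are the ucycles of
   length at least 3; being duplicate-free, they have length at most #|T|. *)
Definition acyclic E : bool :=
  [forall l : 'I_#|T|.+1, forall c : l.-tuple T,
     (2 < l)%N ==> ~~ ucycleb (adj E) c].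

Definition is_tree V E : bool :=
  [&& V != set0, is_graph V E, connected V E & acyclic E].

(* Vertex set, edge set, root. *)
Definition rgraph : finType := ({set T} * {set {set T}} * T)%type.

Definition verts (t : rgraph) : {set T} := t.1.1.
Definition edges (t : rgraph) : {set {set T}} := t.1.2.
Definition root_of (t : rgraph) : T := t.2.

Definition is_rooted_tree (t : rgraph) : bool :=
  is_tree (verts t) (edges t) && (root_of t \in verts t).

(* [verts @: F] is a set, so injectivity of [verts] on F is needed to exclude
   two different trees on the same vertex set. *)
Definition labeled_forest S (F : {set rgraph}) : bool :=
  [&& [forall t in F, is_rooted_tree t],
      dinjectiveb verts F
    & partition (verts @: F) S].

Definition singleton_tree (F : {set rgraph}) (x : T) : bool :=
  [exists t in F, verts t == [set x]].

End Forests.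

(* The label i + 1 of [n + 1] = {1, ..., n + 1} is represented by the ordinal
   i : 'I_n.+1. Meaningful for k <= n. *)
Definition L (n k : nat) : nat :=
  #|[set F : {set rgraph 'I_n.+1} |
      [&& labeled_forest [set: 'I_n.+1] F,
          singleton_tree F (inord k)
        & [forall i : 'I_n.+1, (k < i)%N ==> ~~ singleton_tree F i]]]|.

Definition stirling2 (n j : nat) : nat :=
  #|[set P : {set {set 'I_n}} | partition P [set: 'I_n] & #|P| == j]|.

Definition bell_poly (k : nat) : {poly rat} :=
  \sum_(j < k.+1) (stirling2 k j)%:R *: 'X^j.

Definition binom_poly (p : {poly rat}) (k : nat) : {poly rat} :=
  (k`!%:R)^-1 *: \prod_(i < k) (p - i%:R).

(* Main.v *)
(* Sorting the forests on m + k vertices by which of k given vertices are not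
   singleton trees gives, by Cayley's formula,
     (m + k + 1) ^ (m + k - 1) = sum_j C(k, j) L_{m+j,m},
   i.e., a = L * 1 for the binomial convolution *. Each of the three identities
   reads L * (1 * w) = a * w, with w_j = y^j, B_j(y), C(y, j) respectively:
   1 * w is then (y + 1)^j, B_{j+1}(y) / y and C(y + j, j).
   Cayley's formula is proved by encoding forests as parent maps and summing
   over the set of children of the roots. *)
Require Import Defs.
From mathcomp Require Import all_boot all_order all_algebra.
From mathcomp Require Import zify ring.
Import GRing.Theory.
Local Open Scope ring_scope.

Set Implicit Arguments.
Unset Strict Implicit.
Unset Printing Implicit Defensive.

(** * Binomial convolution *)

(** A parent map is defined on the whole type and is the identity outside the vertex set [S].
    Deleting a singleton tree then shrinks [S] and leaves the map itself unchanged, so singletons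
    can be excluded one vertex at a time. The prescribed singleton of L_{m+k,m} is deleted in the
    same way, which leaves m + k vertices. With l(m, k) = L_{m+k,m} this gives l(m, k + 1) = l(m +
    1, k) - l(m, k) and l(m, 0) = (m + 1)^(m - 1), and a = L * 1 follows by pure algebra: the shift
    of sequences is a derivation of the convolution and fixes the constant sequence 1. The delicate
    half of the encoding is surjectivity, since the edges of a given tree are not oriented: parents
    come from the distance to the root, and acyclicity shows that no other edge exists. *)

Definition bconv (R : pzSemiRingType) (u v : nat -> R) (n : nat) : R :=
  \sum_(k < n.+1) 'C(n, k)%:R * u k * v (n - k)%N.

Lemma eq_bconv (R : pzSemiRingType) (u u' v v' : nat -> R) :
  u =1 u' -> v =1 v' -> bconv u v =1 bconv u' v'.
Proof. by move=> eu ev n; apply: eq_bigr => k _; rewrite eu ev. Qed.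

Lemma bconvDl (R : pzSemiRingType) (u u' v : nat -> R) (n : nat) :
  bconv (fun k => u k + u' k) v n = bconv u v n + bconv u' v n.
Proof.
by rewrite -big_split; apply: eq_bigr => k _; rewrite mulrDr mulrDl.
Qed.

Lemma bconvDr (R : pzSemiRingType) (u v v' : nat -> R) (n : nat) :
  bconv u (fun k => v k + v' k) n = bconv u v n + bconv u v' n.
Proof. by rewrite -big_split; apply: eq_bigr => k _; rewrite mulrDr. Qed.

(** By Pascal's rule the shift acts as a derivation, like d/dz on a product of exponential
    generating functions. *)
Lemma bconv_leibniz (R : pzSemiRingType) (u v : nat -> R) (n : nat) :
  bconv u v n.+1 =
  bconv (fun k => u k.+1) v n + bconv u (fun k => v k.+1) n.
Proof.
rewrite /bconv big_ord_recl /= bin0 subn0.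
have -> : \sum_(i < n.+1) 'C(n.+1, bump 0 i)%:R * u (bump 0 i)
            * v (n.+1 - bump 0 i)%N
        = \sum_(i < n.+1) 'C(n, i)%:R * u i.+1 * v (n - i)%N
          + \sum_(i < n.+1) 'C(n, i.+1)%:R * u i.+1 * v (n - i)%N.
  rewrite -big_split; apply: eq_bigr => i _.
  by rewrite /bump /= add1n binS subSS natrD !mulrDl addrC.
rewrite addrCA; congr (_ + _).
rewrite [in RHS]big_ord_recl /= bin0 subn0; congr (_ + _).
rewrite big_ord_recr /= bin_small // !mul0r addr0.
by apply: eq_bigr => i _; rewrite /bump /= add1n subnSK.
Qed.

(** Both sides obey the same Leibniz rule, so induction over all triples of sequences replaces the
    rearrangement of a double sum. *)
Lemma bconvA (R : pzSemiRingType) (u v w : nat -> R) (n : nat) :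
  bconv (bconv u v) w n = bconv u (bconv v w) n.
Proof.
elim: n u v w => [|n IHn] u v w.
  by rewrite /bconv !big_ord1 !mul1r mulrA.
rewrite !bconv_leibniz (eq_bconv (bconv_leibniz u v) (frefl w)) bconvDl.
rewrite (eq_bconv (frefl u) (bconv_leibniz v w)) bconvDr.
by rewrite !IHn addrA.
Qed.

(** * Binomial coefficients of a polynomial *)

Lemma binom_polyDS (p : {poly rat}) (k : nat) :
  binom_poly (p + 1) k.+1 = binom_poly p k.+1 + binom_poly p k.
Proof.
have low : \prod_(i < k.+1) (p + 1 - i%:R) = (p + 1) * \prod_(i < k) (p - i%:R).
  rewrite big_ord_recl subr0; congr (_ * _); apply: eq_bigr => i _.
  by rewrite /= /bump /= add1n -natr1; ring.
rewrite /binom_poly low big_ord_recr /=.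
set P := \prod_(_ < _) _.
(* Splitting p + 1 as (p - k) + (k + 1) yields the two terms of Pascal's rule; k + 1 cancels against
   (k + 1)!. *)
have -> : (p + 1) * P = P * (p - k%:R) + k.+1%:R * P by rewrite -natr1; ring.
rewrite scalerDr; congr (_ + _).
rewrite mulr_natl -scaler_nat scalerA factS natrM; congr (_ *: _).
rewrite invfM mulrAC mulVf ?mul1r // Num.Theory.pnatr_eq0 //.
Qed.

Lemma binom_poly0 (p : {poly rat}) : binom_poly p 0 = 1.
Proof. by rewrite /binom_poly big_ord0 fact0 invr1 scale1r. Qed.

(** Pascal's rule iterated [d] times. The case d = k exhibits C(p + k, k) as a convolution with the
    constant sequence 1. *)
Lemma binom_poly_vandermonde (p : {poly rat}) (d k : nat) :
  binom_poly (p + d%:R) k = \sum_(i < k.+1) 'C(d, i)%:R * binom_poly p (k - i).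
Proof.
elim: d k => [|d IHd] k.
  rewrite addr0 big_ord_recl bin0 mul1r subn0 big1 ?addr0 // => i _.
  by rewrite mul0r.
case: k => [|k]; first by rewrite big_ord1 !binom_poly0 bin0 mulr1.
rewrite -natr1 addrA binom_polyDS !IHd big_ord_recl [in RHS]big_ord_recl /=.
rewrite !bin0 -addrA; congr (_ + _); rewrite -big_split; apply: eq_bigr => i _.
by rewrite /bump /= add1n binS natrD mulrDl subSS.
Qed.

(** * Counting parent maps *)

Lemma sum_powerset_card (T : finType) (S : {set T}) (h : nat -> nat) :
  (\sum_(A in powerset S) h #|A| = \sum_(k < #|S|.+1) 'C(#|S|, k) * h k)%N.
Proof.
rewrite (partition_big (fun A : {set T} => inord #|A| : 'I_#|S|.+1) predT) //=.
apply: eq_bigr => k _.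
rewrite (eq_bigl [in [set A : {set T} | A \subset S & #|A| == k]]) => [|A].
  rewrite (eq_bigr (fun=> h k)) => [|A]; last first.
    by rewrite !inE => /andP[_ /eqP ->].
  by rewrite sum_nat_const cards_draws.
rewrite !inE; case sAS: (A \subset S) => //=.
by rewrite -val_eqE /= inordK // ltnS subset_leq_card.
Qed.

Definition cayley (n : nat) : nat := ((n + 1) ^ (n - 1))%N.

(* The number of forests on k + n vertices with a prescribed set of k roots;
   it satisfies (k + n) G(n, k) = k (k + n) ^ n. *)
Definition rooted_cayley (n k : nat) : nat :=
  if n is n'.+1 then (k * (k + n) ^ n')%N else 1%N.

(** The identity (i + 1) C(n + 1, i + 1) = (n + 1) C(n, i) turns the sum into k times the binomial
    expansion of (k + n + 1)^n, with n + 1 for the lemma's [n]. *)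
Lemma rooted_cayley_rec (n k : nat) :
  (\sum_(s < n.+1) 'C(n, s) * (k ^ s * rooted_cayley (n - s) s)
    = rooted_cayley n k)%N.
Proof.
case: n => [|n]; first by rewrite big_ord1.
rewrite big_ord_recl /= mul0n !muln0 add0n (addnC k) expnDn big_distrr /=.
apply: eq_bigr => -[i /= le_in] _; rewrite /bump /= add1n subSS.
case Dni: (n - i)%N => [|d] /=.
  have -> : i = n by lia.
  by rewrite !binn !mul1n muln1 expnS.
have -> : (i.+1 + d.+1 = n.+1)%N by lia.
have Dbin := mul_bin_diag n.+1 i; rewrite /= in Dbin.
rewrite [(n.+1 ^ d.+1)%N]expnS [(k ^ i.+1)%N]expnS.
transitivity (i.+1 * 'C(n.+1, i.+1) * (k * k ^ i * n.+1 ^ d))%N.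
  by rewrite !mulnA; lia.
by rewrite -Dbin; lia.
Qed.

(** The recursion at k = 1: the chosen roots become the children of one extra vertex. *)
Lemma cayley_sum (n : nat) :
  (\sum_(s < n.+1) 'C(n, s) * rooted_cayley (n - s) s = cayley n)%N.
Proof.
rewrite (eq_bigr (fun s : 'I_n.+1 =>
           'C(n, s) * (1 ^ s * rooted_cayley (n - s) s))%N) => [|s _].
  rewrite rooted_cayley_rec /cayley; case: n => //= n.
  by rewrite mul1n add1n addn1 subn1.
by rewrite exp1n mul1n.
Qed.

(* Equivalently, every f-orbit leaves N. *)
Definition escaping (T : finType) (f : {ffun T -> T}) (N : {set T}) : bool :=
  [forall B : {set T}, (B \subset N) && (f @: B \subset B) ==> (B == set0)].

(** For disjoint [R] and [N], the parent maps of the forests on their union with root set [R];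
    fixing everything off [N] gives each forest exactly one map. *)
Definition rooted_maps (T : finType) (R N : {set T}) : {set {ffun T -> T}} :=
  [set f : {ffun T -> T} |
    [&& [forall x in ~: N, f x == x], f @: N \subset R :|: N & escaping f N]].

Lemma rooted_mapsP (T : finType) (R N : {set T}) (f : {ffun T -> T}) :
  reflect [/\ forall x, x \notin N -> f x = x,
              forall x, x \in N -> f x \in R :|: N
            & forall B : {set T}, B \subset N ->
                (forall x, x \in B -> f x \in B) -> B = set0]
          (f \in rooted_maps R N).
Proof.
rewrite inE; apply: (iffP and3P) => -[f_id f_N f_esc]; split.
- by move=> x Nx; apply/eqP/(forall_inP f_id); rewrite inE.
- by move=> x Nx; apply: (subsetP f_N); apply: imset_f.
- move=> B sBN fB; apply/eqP/(implyP (forallP f_esc B)); rewrite sBN.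
  by apply/subsetP=> _ /imsetP[x Bx ->]; apply: fB.
- by apply/forall_inP=> x; rewrite inE => /f_id ->.
- by apply/subsetP=> _ /imsetP[x Nx ->]; apply: f_N.
apply/forallP=> B; apply/implyP=> /andP[sBN fB]; apply/eqP/f_esc => // x Bx.
by apply: (subsetP fB); apply: imset_f.
Qed.

(* Sort the maps by the set A of vertices sent directly to R: those of A have
   free images in R, and the rest is a rooted map with A as set of roots. *)
Lemma card_rooted_maps (T : finType) (R N : {set T}) :
  [disjoint R & N] -> #|rooted_maps R N| = rooted_cayley #|N| #|R|.
Proof.
have [n] := ubnP #|N|; elim: n R N => // n IHn R N ltNn dRN.
have RN x : x \in R -> x \in N -> False by move=> Rx; rewrite (disjointFr dRN).
pose top (f : {ffun T -> T}) := [set x in N | f x \in R].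
have [N0 | [x0 Nx0]] := set_0Vmem N.
  rewrite N0 cards0 /=; apply/eqP/cards1P; exists [ffun x => x].
  apply/setP=> f; rewrite !inE; apply/idP/eqP => [|->].
    move=> fR; have /rooted_mapsP[f_id _ _] : f \in rooted_maps R set0.
      by rewrite inE.
    by apply/ffunP=> x; rewrite f_id ?inE ?ffunE.
  have: [ffun x => x] \in rooted_maps R set0 by apply/rooted_mapsP; split=>
    [x _|x|B]; rewrite ?ffunE ?inE // subset0 => /eqP.
  by rewrite inE.
rewrite -rooted_cayley_rec.
rewrite -(sum_powerset_card N
            (fun s => #|R| ^ s * rooted_cayley (#|N| - s) s)%N).
rewrite -sum1_card (partition_big top [in powerset N]) => [|f _] /=; last first.
  by rewrite inE; apply/subsetP=> x; rewrite inE => /andP[].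
apply: eq_bigr => A; rewrite inE => sAN.
(* Forgetting the images of [A] makes [A] the root set of what remains below it. *)
pose low (f : {ffun T -> T}) := [ffun x => if x \in A then x else f x].
(* If nothing is sent to [R], all of [N] is closed under [f] and cannot escape; the formula agrees,
   having a factor 0 for zero roots. *)
have [A0 | [a0 Aa0]] := set_0Vmem A.
  have -> : rooted_cayley (#|N| - #|A|) #|A| = 0%N.
    rewrite A0 cards0 subn0; case DN: #|N| => //.
    by rewrite (cards0_eq DN) inE in Nx0.
  rewrite muln0 big1 // => f /andP[/rooted_mapsP[_ f_N f_esc] /eqP topf].
  suff N0 : N = set0 by rewrite N0 inE in Nx0.
  apply: f_esc => // x Nx; move: (f_N x Nx); rewrite inE => /orP[Rfx|//].
  by have: x \in top f by [rewrite inE Nx Rfx]; rewrite topf A0 inE.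
have cardNA : #|N :\: A| = (#|N| - #|A|)%N by rewrite cardsDS.
have dANA : [disjoint A & N :\: A].
  by rewrite -setI_eq0 setIDA setIC -setIDA setDv setI0.
have ltNA : (#|N :\: A| < n)%N.
  rewrite cardNA; have /card_gt0P : exists x, x \in A by exists a0.
  by have := subset_leq_card sAN; lia.
rewrite -cardNA -(IHn A (N :\: A) ltNA dANA) mulnC -sum_nat_const.
have AN x : x \in A -> x \in N by apply/subsetP.
have topE f x : top f = A -> (x \in A) = (x \in N) && (f x \in R).
  by move <-; rewrite inE.
rewrite (partition_big low [in rooted_maps A (N :\: A)]) => [|f] /=; last first.
  case/andP=> /rooted_mapsP[f_id f_N f_esc] /eqP topf.
  apply/rooted_mapsP; split=> [x|x|B].
  - rewrite ffunE inE; case: ifP => //= _; exact: f_id.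
  - rewrite ffunE !inE => /andP[nAx Nx]; rewrite (negPf nAx).
    move: (f_N x Nx) nAx; rewrite (topE f x topf) Nx /= => /setUP[->//|Nfx _].
    by rewrite Nfx andbT orbN.
  move=> /subsetP sB Bf; apply: f_esc.
    by apply/subsetP=> x /sB; rewrite inE => /andP[].
  move=> x Bx; have:= Bf x Bx; rewrite ffunE; case: ifP => // Ax.
  by have:= sB x Bx; rewrite inE Ax.
apply: eq_bigr => g /rooted_mapsP[g_id g_N g_esc].
rewrite sum1dep_card.
(* The fibre of [low] over [g]: values on [A] are free in [R], all others are dictated by [g]. *)
rewrite (eq_card (B := family (fun x =>
                         if x \in A then mem R else mem (pred1 (g x))))).
  rewrite card_family foldrE big_map big_enum /=.
  rewrite (bigID [in A]) /= [X in (_ * X)%N]big1 ?muln1 => [|x nAx]; last first.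
    by rewrite (negPf nAx) card1.
  rewrite (eq_bigr (fun=> #|R|)) => [|x ->//].
  by rewrite prod_nat_const.
move=> f; rewrite inE; apply/idP/familyP => [|fF].
  case/andP=> /andP[/rooted_mapsP[f_id f_N f_esc] /eqP topf] /eqP <- x.
  rewrite ffunE; case Ax: (x \in A); last exact: eqxx.
  by move: Ax; rewrite (topE f) // => /andP[].
have fA x : x \in A -> f x \in R by have := fF x; case: ifP.
have fnA x : x \notin A -> f x = g x.
  by have := fF x; case: ifP => // _ /eqP.
have gN x : x \in N -> x \notin A -> g x \in N.
  move=> Nx nAx; have:= g_N x; rewrite !inE nAx Nx => /(_ isT).
  by case/orP=> [/AN|/andP[]].
have topf : top f = A.
  apply/setP=> x; rewrite inE; case Ax: (x \in A); first by rewrite AN // fA.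
  case Nx: (x \in N) => //=; rewrite fnA ?Ax //; apply/negP=> /RN; apply.
  by apply: gN; rewrite ?Ax.
rewrite topf eqxx andbT; apply/andP; split; last first.
  apply/eqP/ffunP=> x; rewrite ffunE; case: ifP => Ax; last by rewrite fnA ?Ax.
  by rewrite g_id // inE Ax.
apply/rooted_mapsP; split=> [x nNx|x Nx|B sBN fB].
- have nAx : x \notin A by apply: contra nNx; apply: AN.
  by rewrite fnA // g_id // inE (negPf nNx) andbF.
- case Ax: (x \in A); first by rewrite inE fA.
  by rewrite inE fnA ?Ax // gN ?Ax ?orbT.
(* A closed subset of [N] misses [A], whose image lies in [R]; on it [f] and [g] agree. *)
have nBA x : x \in B -> x \notin A.
  move=> Bx; apply/negP=> /fA Rfx; apply: (RN _ Rfx).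
  by apply: (subsetP sBN); apply: fB.
apply: g_esc => [|x Bx]; last by rewrite -fnA ?nBA //; apply: fB.
by apply/subsetP=> x Bx; rewrite inE nBA // (subsetP sBN).
Qed.

(* A rooted forest on S is encoded by its parent map; the roots are the fixed
   points in S, and the points outside S are fixed as well. *)
Definition parent_maps (T : finType) (S : {set T}) : {set {ffun T -> T}} :=
  [set f : {ffun T -> T} |
    [&& [forall x in ~: S, f x == x], f @: S \subset S
      & [forall B : {set T}, [&& B \subset S, f @: B \subset B & B != set0]
           ==> [exists x in B, f x == x]]]].

Lemma parent_mapsP (T : finType) (S : {set T}) (f : {ffun T -> T}) :
  reflect [/\ forall x, x \notin S -> f x = x,
              forall x, x \in S -> f x \in S
            & forall B : {set T}, B \subset S ->
                (forall x, x \in B -> f x \in B) -> B != set0 ->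
                exists2 x, x \in B & f x = x]
          (f \in parent_maps S).
Proof.
rewrite inE; apply: (iffP and3P) => -[f_id f_S f_fix]; split.
- by move=> x Sx; apply/eqP/(forall_inP f_id); rewrite inE.
- by move=> x Sx; apply: (subsetP f_S); apply: imset_f.
- move=> B sBS fB B0.
  suff /exists_inP[x Bx /eqP fx] : [exists x in B, f x == x] by exists x.
  apply: (implyP (forallP f_fix B)); rewrite sBS B0 andbT.
  by apply/subsetP=> _ /imsetP[x Bx ->]; apply: fB.
- by apply/forall_inP=> x; rewrite inE => /f_id ->.
- by apply/subsetP=> _ /imsetP[x Sx ->]; apply: f_S.
apply/forallP=> B; apply/implyP=> /and3P[sBS fB B0].
have [||x Bx fx] := f_fix B sBS; last first.
- by apply/exists_inP; exists x => //; apply/eqP.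
- by [].
by move=> x Bx; apply: (subsetP fB); apply: imset_f.
Qed.

(** Once the set [A] of fixed points in [S] is given, the parent maps are the rooted maps from
    [S :\: A] with roots [A]. *)
Lemma card_parent_maps (T : finType) (S : {set T}) :
  #|parent_maps S| = cayley #|S|.
Proof.
pose fix_in (f : {ffun T -> T}) := [set x in S | f x == x].
rewrite -cayley_sum.
rewrite -(sum_powerset_card S (fun s => rooted_cayley (#|S| - s) s)).
rewrite -sum1_card (partition_big fix_in [in powerset S]) => [|f _] /=;
  last first.
  by rewrite inE; apply/subsetP=> x; rewrite inE => /andP[].
apply: eq_bigr => A; rewrite inE => sAS.
have dASA : [disjoint A & S :\: A].
  by rewrite -setI_eq0 setIDA setIC -setIDA setDv setI0.
rewrite -cardsDS // -card_rooted_maps // sum1dep_card; apply: eq_card => f.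
have AS : A :|: S :\: A = S.
  by rewrite setDE setUIr setUCr setIT; apply/setUidPr.
rewrite inE; apply/idP/idP.
  case/andP=> /parent_mapsP[f_id f_S f_fix] /eqP fixA.
  apply/rooted_mapsP; rewrite AS; split=> [x|x|B sB fB].
  - rewrite inE negb_and negbK -fixA inE => /orP[/andP[_ /eqP]//|]; exact: f_id.
  - by rewrite inE => /andP[_]; apply: f_S.
  apply/eqP; apply: contraT => B0.
  have [x Bx fx] := f_fix B (subset_trans sB (subsetDl _ _)) fB B0.
  by have := subsetP sB x Bx; rewrite inE -fixA inE fx eqxx andbT andNb.
case/rooted_mapsP=> f_id; rewrite AS => f_S f_esc.
have fA x : x \in A -> f x = x by move=> Ax; apply: f_id; rewrite inE Ax.
apply/andP; split.
  apply/parent_mapsP; split=> [x nSx|x Sx|B sBS fB B0].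
  - by rewrite f_id // inE (negPf nSx) andbF.
  - case Ax: (x \in A); first by rewrite fA.
    by apply: f_S; rewrite inE Ax.
  have [BA0|[x]] := set_0Vmem (B :&: A).
    case/eqP: B0; apply: f_esc => //.
    by rewrite subsetD sBS -setI_eq0 BA0 eqxx.
  by rewrite inE => /andP[Bx Ax]; exists x; rewrite ?fA.
apply/eqP/setP=> x; rewrite inE; apply/andP/idP => [[Sx /eqP fx]|Ax].
  apply: contraT => nAx.
  (* A fixed point off [A] would by itself be a closed set that never escapes. *)
  suff /setP/(_ x) : [set x] = set0 by rewrite !inE eqxx.
  apply: f_esc => [|z /set1P ->]; last by rewrite fx set11.
  by rewrite sub1set inE nAx.
by rewrite (subsetP sAS) // fA.
Qed.

(** * Excluding isolated vertices *)

Definition isolated (T : finType) (f : {ffun T -> T}) (x : T) : bool :=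
  [forall y, (f y == x) == (y == x)].

Lemma isolatedP (T : finType) (f : {ffun T -> T}) (x : T) :
  reflect (f x = x /\ forall y, f y = x -> y = x) (isolated f x).
Proof.
apply: (iffP forallP) => [fxP|[fx fy] y].
  split; first by apply/eqP; rewrite (eqP (fxP x)).
  by move=> y /eqP; rewrite (eqP (fxP y)) => /eqP.
by apply/eqP; apply/eqP/eqP => [/fy|->].
Qed.

(** The same function serves for both vertex sets: a deleted vertex must be fixed, just as an
    isolated root is, and no other vertex may map to it. *)
Lemma parent_mapsD1 (T : finType) (S : {set T}) (x : T) (f : {ffun T -> T}) :
  x \in S ->
  (f \in parent_maps (S :\ x)) = (f \in parent_maps S) && isolated f x.
Proof.
move=> Sx; apply/idP/andP => [/parent_mapsP[f_id f_S f_fix] | []].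
  have fx : f x = x by apply: f_id; rewrite !inE eqxx.
  split.
    apply/parent_mapsP; split=> [y nSy|y Sy|B sBS fB B0].
    - by rewrite f_id // inE (negPf nSy) andbF.
    - have [->|nyx] := eqVneq y x; first by rewrite fx.
      by have /setD1P[] : f y \in S :\ x by apply: f_S; rewrite !inE nyx.
    have [Bx|nBx] := boolP (x \in B); first by exists x.
    by apply: f_fix => //; rewrite subsetD1 sBS.
  apply/isolatedP; split=> // y fy; apply/eqP; apply: contraT => nyx.
  have [Sy|nSy] := boolP (y \in S).
    by have := f_S y; rewrite !inE nyx Sy fy eqxx => /(_ isT).
  by move: nyx; rewrite -fy f_id ?eqxx // inE (negPf nSy) andbF.
move=> /parent_mapsP[f_id f_S f_fix] /isolatedP[fx fy].
apply/parent_mapsP; split=> [y|y|B]; rewrite ?inE.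
- by rewrite negb_and negbK => /orP[/eqP ->|/f_id].
- case/andP=> nyx Sy; rewrite f_S // andbT.
  by apply: contraNneq nyx => /fy ->.
by rewrite subsetD1 => /andP[sBS _]; apply: f_fix.
Qed.

(** The [k]-th finite difference of [cayley] at [m], taken in a ring so that subtraction is not
    truncated. *)
Fixpoint nonsingleton_forests (R : pzRingType) (m k : nat) : R :=
  if k is k'.+1
  then nonsingleton_forests R m.+1 k' - nonsingleton_forests R m k'
  else (cayley m)%:R.

(** For x in [U], impose the condition on [U :\ x] only and subtract the maps where x is isolated;
    these are the maps on [S :\ x]. *)
Lemma card_parent_maps_nonisolated
    (R : pzRingType) (T : finType) (S U : {set T}) :
  U \subset S ->
  #|[set f in parent_maps S | [forall x in U, ~~ isolated f x]]|%:R
    = nonsingleton_forests R (#|S| - #|U|) #|U|.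
Proof.
have [k] := ubnP #|U|; elim: k S U => // k IHk S U ltUk sUS.
have [U0 | [x Ux]] := set_0Vmem U.
  rewrite U0 cards0 subn0 /= -card_parent_maps; congr _%:R; apply: eq_card => f.
  rewrite inE; case: (f \in _) => //=.
  by apply/forall_inP=> x; rewrite inE.
have Sx := subsetP sUS x Ux.
have DU := cardsD1 x U; rewrite Ux in DU.
have DS := cardsD1 x S; rewrite Sx in DS.
have leU : (#|U :\ x| <= #|S :\ x|)%N by apply: subset_leq_card; apply: setSD.
have -> : (#|S| - #|U| = #|S :\ x| - #|U :\ x|)%N by lia.
rewrite DU add1n /= -(IHk (S :\ x)) ?setSD //; last by lia.
have -> : (#|S :\ x| - #|U :\ x|).+1 = (#|S| - #|U :\ x|)%N by lia.
rewrite -(IHk S); [|lia|by apply: subset_trans (subsetDl _ _) sUS].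
set W := [set f in parent_maps S | [forall y in U :\ x, _]].
have -> : [set f in parent_maps (S :\ x) |
              [forall y in U :\ x, ~~ isolated f y]]
          = W :&: [set f | isolated f x].
  apply/setP=> f; rewrite in_set parent_mapsD1 // in_setI [f \in W]in_set.
  by rewrite [X in _ = _ && X]in_set andbAC.
rewrite -natrB ?subset_leq_card ?subsetIl // -cardsDS ?subsetIl //.
rewrite setDIr setDv set0U; congr _%:R; apply: eq_card => f.
rewrite in_set in_setD [f \in W]in_set [X in ~~ X && _]in_set andbCA.
congr (_ && _); apply/forall_inP/andP => [U_f|[x_f /forall_inP U_f] y Uy].
  by split; [exact: U_f | apply/forall_inP=> y /setD1P[_ /U_f]].
by have [->//|nyx] := eqVneq y x; apply: U_f; apply/setD1P.
Qed.

(** * Forests and parent maps *)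

Lemma adj_sym (T : finType) (E : {set {set T}}) : symmetric (adj E).
Proof. by move=> x y; rewrite /adj /= setUC. Qed.

Lemma parent_mapsTP (T : finType) (f : {ffun T -> T}) :
  reflect (forall x, exists2 r, f r = r & fconnect f x r)
          (f \in parent_maps setT).
Proof.
apply: (iffP idP) => [/parent_mapsP[_ _ f_fix] x | f_fix].
  have [|||r] := f_fix [set y | fconnect f x y]; first exact: subsetT.
  - by move=> y; rewrite !inE => xy; apply: connect_trans xy (fconnect1 f y).
  - by apply/set0Pn; exists x; rewrite inE.
  by rewrite inE; exists r.
apply/parent_mapsP; split=> [x||B _ fB]; rewrite ?inE // => /set0Pn[x Bx].
have [r fr /iter_findex Dr] := f_fix x; exists r => //; rewrite -Dr.
by elim: (findex f x r) => //= k; apply: fB.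
Qed.

Lemma fconnect_fixed (T : finType) (f : T -> T) (x y : T) :
  f x = x -> fconnect f x y -> y = x.
Proof. by move=> fx /iter_findex <-; elim: findex => //= k ->. Qed.

Lemma fconnect_fixed_inj (T : finType) (f : T -> T) (x r r' : T) :
  f r = r -> f r' = r' -> fconnect f x r -> fconnect f x r' -> r = r'.
Proof.
move=> fr fr' /iter_findex Dr /iter_findex Dr'.
have iter_fix s k : f s = s -> iter k f s = s by move=> fs; elim: k => //= k ->.
have : iter (findex f x r') f (iter (findex f x r) f x)
     = iter (findex f x r) f (iter (findex f x r') f x).
  by rewrite -!iterD addnC.
by rewrite Dr Dr' !iter_fix.
Qed.

Lemma fconnect_step (T : finType) (f : T -> T) (x y : T) :
  fconnect f x y -> x != y -> fconnect f (f x) y.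
Proof.
move=> /iter_findex <-; case: (findex f x y) => [|k _]; first by rewrite eqxx.
by rewrite iterSr fconnect_iter.
Qed.

(** For a parent map, [order f x] counts the vertices on the way from x to its root, so it serves as
    a depth. It could fail to drop only if x lay on a cycle. *)
Lemma order_parent (T : finType) (f : {ffun T -> T}) (x : T) :
  f \in parent_maps setT -> f x != x -> (order f (f x) < order f x)%N.
Proof.
move=> /parent_mapsP[_ _ f_fix] nfx; apply: proper_card; apply/properP; split.
  by apply/subsetP=> y; apply: connect_trans (fconnect1 f x).
exists x; first exact: connect0.
apply/negP=> fxx; have [|||r] := f_fix [set y | fconnect f y x].
- exact: subsetT.
- move=> y; rewrite !inE => yx; have [->//|nyx] := eqVneq y x.
  exact: fconnect_step.
- by apply/set0Pn; exists x; rewrite inE connect0.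
rewrite inE => rx fr; case/eqP: nfx.
by rewrite (fconnect_fixed fr rx).
Qed.

Definition parent_tree (T : finType) (f : {ffun T -> T}) (r : T) :
    Defs.rgraph T :=
  ([set x | fconnect f x r],
   [set [set x; f x] | x in [set x | fconnect f x r & x != r]],
   r).

Definition parent_forest (T : finType) (f : {ffun T -> T}) :
    {set Defs.rgraph T} :=
  [set parent_tree f r | r in [set r | f r == r]].

Lemma parent_treeE (T : finType) (f : {ffun T -> T}) (r x y : T) :
  adj (edges (parent_tree f r)) x y ->
  [/\ fconnect f x r, fconnect f y r & y = f x /\ x != r \/ x = f y /\ y != r].
Proof.
case/imsetP=> z; rewrite !inE => /andP[zr nzr] xyz.
have fzr := fconnect_step zr nzr.
have /set2P[Dx|Dx] : x \in [set z; f z] by rewrite -xyz set21.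
  have /set2P[Dy|Dy] : y \in [set z; f z] by rewrite -xyz set22.
    have /set2P : f z \in [set x; y] by rewrite xyz set22.
    by rewrite Dx Dy => -[] fz; split=> //; left.
  by rewrite Dx Dy; split=> //; left.
have /set2P[Dy|Dy] : y \in [set z; f z] by rewrite -xyz set22.
  by rewrite Dx Dy; split=> //; right.
have /set2P : z \in [set x; y] by rewrite xyz set21.
by rewrite Dx Dy => -[] fz; rewrite -fz; split=> //; left; rewrite -fz.
Qed.

Lemma ucycle_neighbours (T : eqType) (e : rel T) (x : T) (c : seq T) :
  ucycleb e (x :: c) -> (1 < size c)%N ->
  exists y z, [/\ y \in c, z \in c, e x y, e z x & y != z].
Proof.
case: c => [|y []] // w c /andP[cyc uniq_c] _; exists y, (last w c).
have := cyc; rewrite /= rcons_path => /and3P[-> _ /andP[_ ->]].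
have lastc := mem_last w c; split=> //; first exact: mem_head.
  by rewrite inE lastc orbT.
by move: uniq_c => /= /and3P[_ yc _]; apply: contraNneq yc => ->.
Qed.

Lemma parent_tree_rooted (T : finType) (f : {ffun T -> T}) (r : T) :
  f \in parent_maps setT -> f r = r -> is_rooted_tree (parent_tree f r).
Proof.
move=> fP fr; rewrite /is_rooted_tree /= inE connect0 andbT; apply/and4P; split.
- by apply/set0Pn; exists r; rewrite inE connect0.
- apply/forall_inP=> _ /imsetP[x /[!inE] /andP[xr nxr] ->]; apply/andP; split.
    apply/subsetP=> y /set2P[] ->; rewrite inE //; exact: fconnect_step.
  rewrite cards2; have [fx|//] := eqVneq x (f x).
  by rewrite (fconnect_fixed (esym fx) xr) eqxx in nxr.
- have to_r x : fconnect f x r -> connect (adj (edges (parent_tree f r))) x r.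
    move=> /[dup] xr /iter_findex; move: (findex f x r) => k.
    elim: k x xr => [|k IHk] x xr /=.
      by move=> ->; apply: connect0.
    rewrite -iterS iterSr; have [-> _|nxr] := eqVneq x r; first exact: connect0.
    move/(IHk _ (fconnect_step xr nxr)); apply: connect_trans.
    by apply: connect1; apply/imsetP; exists x; rewrite ?inE ?xr.
  apply/forall_inP=> x /[!inE] xr; apply/forall_inP=> y /[!inE] yr.
  apply: connect_trans (to_r x xr) _.
  by rewrite (sym_connect_sym (@adj_sym _ _)) to_r.
apply/forallP=> l; apply/forallP=> c; apply/implyP=> l_gt2; apply/negP=> cyc.
have x0 : T by case: (tval c) (size_tuple c) => [|x] //=; lia.
(* At a deepest vertex of a cycle neither neighbour can be a child, so both are the parent; but a
   cycle of length at least 3 has two distinct neighbours there. *)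
have [x xc x_max] : exists2 x, x \in (c : seq T) &
    forall y, y \in (c : seq T) -> (order f y <= order f x)%N.
  have c0 : nth x0 c 0 \in (c : seq T).
    by apply: mem_nth; rewrite size_tuple; lia.
  by case: (arg_maxnP (order f) c0) => x xc x_max; exists x.
have [i c' Dc] := rot_to xc.
have cyc' : ucycleb (adj (edges (parent_tree f r))) (x :: c').
  by rewrite -Dc /ucycleb rot_cycle rot_uniq.
have memc y : (y \in (c : seq T)) = (y \in x :: c') by rewrite -Dc mem_rot.
have szc : (1 < size c')%N.
  have := congr1 size Dc; rewrite size_rot size_tuple /= => Dl.
  by rewrite -ltnS -Dl.
have fy y : y \in (c : seq T) -> adj (edges (parent_tree f r)) x y -> y = f x.
  move=> /x_max le_yx /parent_treeE[_ yr [[->]|[Dx nyr]]] //.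
  have nfy : f y != y.
    by apply: contraNneq nyr => fy; rewrite (fconnect_fixed fy yr).
  by have := order_parent fP nfy; rewrite -Dx; lia.
have [y [z [yc zc xy zx]]] := ucycle_neighbours cyc' szc.
rewrite adj_sym in zx.
by rewrite (fy y) 1?(fy z) ?eqxx // memc inE ?yc ?zc orbT.
Qed.

Lemma parent_forest_labeled (T : finType) (f : {ffun T -> T}) :
  f \in parent_maps setT -> labeled_forest setT (parent_forest f).
Proof.
move=> fP; have /parent_mapsTP f_fix := fP; apply/and3P; split.
- apply/forall_inP=> _ /imsetP[r /[!inE] /eqP fr ->].
  exact: parent_tree_rooted.
- apply/dinjectiveP=> t t' /imsetP[r /[!inE] /eqP fr ->] /imsetP[r' _ ->].
  move=> /= /setP/(_ r); rewrite !inE connect0 => /esym rr'.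
  by rewrite (fconnect_fixed fr rr').
apply/and3P; split.
- apply/eqP/setP=> x; rewrite inE; have [r fr xr] := f_fix x.
  apply/bigcupP; exists (verts (parent_tree f r)); last by rewrite inE.
  by apply/imset_f/imsetP; exists r; rewrite ?inE ?fr.
- apply/trivIsetP=> V V' /imsetP[_ /imsetP[r /[!inE] /eqP fr ->] ->].
  move=> /imsetP[_ /imsetP[r' /[!inE] /eqP fr' ->] ->] nVV.
  rewrite -setI_eq0; apply: contraNT nVV => /set0Pn[x].
  by rewrite !inE => /andP[xr xr']; rewrite (fconnect_fixed_inj fr fr' xr xr').
apply/imsetP=> -[_ /imsetP[r _ ->] /setP/(_ r)].
by rewrite !inE connect0.
Qed.

Lemma singleton_parent_forest (T : finType) (f : {ffun T -> T}) (x : T) :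
  singleton_tree (parent_forest f) x = isolated f x.
Proof.
apply/exists_inP/isolatedP => [[_ /imsetP[r /[!inE] /eqP fr ->]]|[fx fy]].
  move=> /= /eqP /setP Vr; have := Vr r; rewrite !inE connect0 => /esym/eqP Dr.
  subst r; split=> // y fy; apply/eqP.
  by have := Vr y; rewrite !inE -{1}fy fconnect1 => <-.
exists (parent_tree f x); first by apply/imsetP; exists x; rewrite ?inE ?fx.
apply/eqP/setP=> y; rewrite !inE; apply/idP/eqP => [|->]; last exact: connect0.
move/iter_findex; move: (findex f y x) => k.
elim: k y => //= k IHk y; rewrite -iterS iterSr.
by move/IHk/fy.
Qed.

Lemma parent_forest_inj (T : finType) :
  {in parent_maps [set: T] &, injective (@parent_forest T)}.
Proof.
move=> f g fP gP eq_fg.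
have eq_fixed (h h' : {ffun T -> T}) x :
    parent_forest h = parent_forest h' -> h x = x ->
    h' x = x /\ parent_tree h x = parent_tree h' x.
  move=> eq_h hx; have : parent_tree h x \in parent_forest h.
    by apply/imsetP; exists x; rewrite ?inE ?hx.
  rewrite eq_h => /imsetP[r /[!inE] /eqP hr eq_t].
  by have Dr : x = r := congr1 (@root_of T) eq_t; subst r.
apply/ffunP=> x; have [n] := ubnP (order f x); elim: n x => // n IHn x lt_x.
have [fx|nfx] := eqVneq (f x) x.
  by have [-> _] := eq_fixed f g x eq_fg fx.
have /parent_mapsTP/(_ x)[r fr xr] := fP.
have [gr eq_t] := eq_fixed f g r eq_fg fr.
have nxr : x != r by apply: contraNneq nfx => ->; rewrite fr.
have : [set x; f x] \in edges (parent_tree f r).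
  by apply/imsetP; exists x; rewrite ?inE ?xr.
rewrite eq_t => /parent_treeE[_ _ [[]|[Dx nfxr]]] //.
have lt_fx := order_parent fP nfx.
(* The shared edge may be read downwards in [g], as x = g (f x). By induction [g] agrees with [f] at
   f x, so x = f (f x), against the drop in depth. *)
rewrite -IHn in Dx; last by lia.
have nffx : f (f x) != f x.
  by rewrite -Dx eq_sym.
by have := order_parent fP nffx; rewrite -Dx; lia.
Qed.

(* Breadth-first search: d x is the distance from x to R. *)
Lemma descent_map (T : finType) (e : rel T) (R : {set T}) :
  (forall x, exists2 r, r \in R & connect e x r) ->
  exists d : T -> nat, exists f : {ffun T -> T},
    (forall x, x \in R -> f x = x)
    /\ (forall x, x \notin R -> e x (f x) /\ (d (f x) < d x)%N).
Proof.
move=> toR.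
pose reach x k := [exists p : k.-tuple T, path e x p && (last x p \in R)].
have reachP x p : path e x p -> last x p \in R -> reach x (size p).
  by move=> ep Rp; apply/existsP; exists (in_tuple p); rewrite ep.
have ex_reach x : exists k, reach x k.
  have [r Rr /connectP[p ep Dr]] := toR x.
  by exists (size p); apply: reachP; rewrite -?Dr.
pose d x := ex_minn (ex_reach x).
have next x : x \notin R -> exists y, e x y && (d y < d x)%N.
  rewrite /d; case: (ex_minnP (ex_reach x)) => k /existsP[p /andP[]].
  case: p => -[|y p] /= /eqP Dk; first by move=> _ ->.
  case/andP=> exy ep Rp _ _; exists y; rewrite exy -Dk ltnS.
  by case: ex_minnP => j _; apply; apply: reachP.
exists d; exists [ffun x => if x \in R then x else
              if [pick y | e x y && (d y < d x)%N] is Some y then y else x].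
split=> x Rx; rewrite ffunE ?Rx // (negPf Rx).
case: pickP => [y /andP[]//|none].
by have [y] := next x Rx; rewrite none.
Qed.

(** Otherwise a simple path from x to y in [E'] has at least two edges, and the edge between x and y
    closes it to a simple cycle in [E]. Hence a connected spanning subgraph of a tree is the whole
    tree. *)
Lemma acyclic_connect_edge (T : finType) (E E' : {set {set T}}) (x y : T) :
  acyclic E -> E' \subset E -> x != y -> [set x; y] \in E ->
  connect (adj E') x y -> [set x; y] \in E'.
Proof.
move=> acE /subsetP sE nxy Exy /connectP[p0 Ep0 Dy].
case/shortenP: Ep0 Dy => p Ep Up _ Dy; apply: contraT => nE'xy.
have sp : (1 < size p)%N.
  case: p Ep {Up} Dy => [|z []] //=.
    by move=> _ Dy; rewrite Dy eqxx in nxy.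
  by rewrite andbT => E'xz Dy; case/negP: nE'xy; rewrite Dy; exact: E'xz.
have lt_p : (size (x :: p) < #|T|.+1)%N.
  by rewrite ltnS -(card_uniqP Up) max_card.
have /implyP/(_ _)/negP[] :=
  forallP (forallP acE (Ordinal lt_p)) (in_tuple (x :: p)).
  by [].
rewrite /ucycleb Up andbT /= rcons_path -Dy; apply/andP; split.
  by apply: sub_path Ep => u v; apply: sE.
by rewrite /adj /= setUC.
Qed.

(** The search runs in the union of all edge sets; since the vertex sets are disjoint, each step
    stays in its tree and leads to the root of that tree. The edges from vertices to parents connect
    the tree, so by acyclicity they are all its edges. *)
Lemma parent_forest_surj (T : finType) (F : {set Defs.rgraph T}) :
  labeled_forest setT F ->
  exists2 f, f \in parent_maps setT & F = parent_forest f.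
Proof.
case/and3P=> /forall_inP F_tree /dinjectiveP F_inj.
case/and3P=> /eqP F_cover F_triv _.
pose E := \bigcup_(t in F) edges t.
pose R := [set root_of t | t in F].
have F_eq t t' x :
    t \in F -> t' \in F -> x \in verts t -> x \in verts t' -> t = t'.
  move=> Ft Ft' tx t'x; apply: F_inj => //; apply/eqP.
  have /trivIsetP/(_ (verts t) (verts t')) := F_triv; rewrite !imset_f //.
  move=> /(_ isT isT); case: eqP => // _ /(_ isT).
  by move/disjoint_setI0/setP/(_ x); rewrite !inE tx t'x.
have F_mem x : exists2 t, t \in F & x \in verts t.
  have : x \in cover [set verts t | t in F] by rewrite F_cover.
  by case/bigcupP=> _ /imsetP[t Ft ->]; exists t.
have F_root t : t \in F -> root_of t \in verts t by move/F_tree/andP=> [].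
have F_graph t x y : t \in F -> adj (edges t) x y ->
    [/\ x \in verts t, y \in verts t & x != y].
  move=> /F_tree/andP[/and4P[_ /forall_inP tE _ _] _] /tE.
  rewrite subUset !sub1set cards2 => /andP[/andP[-> ->]].
  by case: (eqVneq x y).
have F_adj t x y : t \in F -> x \in verts t -> adj E x y -> adj (edges t) x y.
  move=> Ft tx /bigcupP[t' Ft' xy].
  have [t'x _ _] := F_graph t' x y Ft' xy.
  by rewrite (F_eq t t' x).
have toR x : exists2 r, r \in R & connect (adj E) x r.
  have [t Ft tx] := F_mem x; exists (root_of t); first exact: imset_f.
  have /andP[/and4P[_ _ /forall_inP t_conn _] _] := F_tree t Ft.
  have := forall_inP (t_conn x tx) _ (F_root t Ft).
  apply: connect_sub => u v uv; apply: connect1; apply/bigcupP.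
  by exists t.
have [d [f [fR f_desc]]] := descent_map toR.
have fix_R r : f r = r -> r \in R.
  by move=> fr; apply: contraT => /f_desc[_]; rewrite fr ltnn.
have fP : f \in parent_maps setT.
  apply/parent_mapsP; split=> [x||B _ fB]; rewrite ?inE // => /set0Pn[x0 Bx0].
  (* A point of a closed set nearest to [R] lies in [R], since its parent would be nearer. *)
  case: (arg_minnP d Bx0) => x Bx x_min; exists x => //; apply: fR.
  by apply: contraT => /f_desc[_]; rewrite ltnNge x_min //; apply: fB.
have /parent_mapsTP f_fix := fP.
have f_vert t x : t \in F -> x \in verts t -> f x \in verts t.
  move=> Ft tx; have [/fR -> //|/f_desc[xfx _]] := boolP (x \in R).
  by case: (F_graph t x (f x) Ft); rewrite ?F_adj.
have f_root t x : t \in F -> x \in verts t -> fconnect f x (root_of t).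
  move=> Ft tx; have [r fr xr] := f_fix x.
  have tr : r \in verts t.
    by have /iter_findex <- := xr; elim: findex => //= k; apply: f_vert.
  have /imsetP[t' Ft' Dr] := fix_R r fr.
  have -> : t = t' by apply: (F_eq _ _ r) => //; rewrite Dr F_root.
  by rewrite -Dr.
have F_treeE t : t \in F -> parent_tree f (root_of t) = t.
  move=> Ft; have f_rt : f (root_of t) = root_of t by apply/fR/imset_f.
  have Dverts : verts (parent_tree f (root_of t)) = verts t.
    apply/setP=> x; rewrite inE; apply/idP/idP; last exact: f_root.
    have [t' Ft' t'x] := F_mem x => x_rt.
    have t'rt := f_root t' x Ft' t'x.
    have Drt : root_of t = root_of t'.
      by apply: fconnect_fixed_inj x_rt t'rt => //; apply/fR/imset_f.
    by rewrite (F_eq t t' (root_of t)) ?F_root // Drt F_root.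
  have sE : edges (parent_tree f (root_of t)) \subset edges t.
    apply/subsetP=> _ /imsetP[x /[!inE] /andP[x_rt nx_rt] ->].
    have tx : x \in verts t by rewrite -Dverts inE.
    apply: F_adj => //; apply: (proj1 (f_desc x _)).
    by apply: contraNN nx_rt => /fR fx; rewrite (fconnect_fixed fx x_rt).
  have Dedges : edges (parent_tree f (root_of t)) = edges t.
    apply/eqP; rewrite eqEsubset sE; apply/subsetP=> xy Exy.
    have /andP[/and4P[_ /forall_inP t_graph _ t_acyclic] _] := F_tree t Ft.
    have /andP[sxy /cards2P[x [y [nxy Dxy]]]] := t_graph _ Exy; subst xy.
    apply: (acyclic_connect_edge t_acyclic sE nxy Exy).
    have /andP[/and4P[_ _ conn _] _] := parent_tree_rooted fP f_rt.
    move: sxy; rewrite subUset !sub1set => /andP[tx ty].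
    by apply: (forall_inP (forall_inP conn x _) y); rewrite Dverts.
  clear -Dverts Dedges; case: t Dverts Dedges => -[V Et] r.
  by rewrite /verts /edges /= => <- <-.
exists f => //; apply/setP=> t; apply/idP/imsetP => [Ft|[r]].
  exists (root_of t); last by rewrite F_treeE.
  by rewrite inE; apply/eqP/fR/imset_f.
rewrite inE => /eqP/fix_R/imsetP[t' Ft' ->] ->.
by rewrite F_treeE.
Qed.

(** * Bell polynomials and the identities *)

(** Deleting the prescribed singleton, the ordinal [m], leaves m + k vertices; the [k] larger ones
    are those that must not be singletons. *)
Lemma L_nonsingleton_forests (R : pzRingType) (m k : nat) :
  (L (m + k) m)%:R = nonsingleton_forests R m k.
Proof.
pose T := 'I_(m + k).+1; pose x : T := inord m.
pose U := [set i : T | (m < i)%N].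
have nUx : x \notin U by rewrite inE inordK ?ltnn //; lia.
have cardU : #|U| = k.
  rewrite -sum1dep_card -(big_geq_mkord m.+1 _ predT (fun=> 1%N)).
  by rewrite sum_nat_const_nat muln1; lia.
have cardS : #|[set: T] :\ x| = (m + k)%N.
  by have := cardsD1 x [set: T]; rewrite cardsT card_ord inE => -[].
have sU : U \subset [set: T] :\ x by rewrite subsetD1 subsetT.
have := card_parent_maps_nonisolated R sU; rewrite cardU cardS addnK => <-.
congr _%:R; rewrite /L.
rewrite -(card_in_imset (f := @parent_forest T)); last first.
  move=> f g; rewrite [f \in _]in_set [g \in _]in_set.
  rewrite !parent_mapsD1 ?in_setT //.
  move=> /andP[/andP[fP _] _] /andP[/andP[gP _] _].
  by apply: parent_forest_inj.
apply: eq_card => F; rewrite in_set; apply/and3P/imsetP.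
  case=> F_forest; have [f fP ->] := parent_forest_surj F_forest.
  rewrite singleton_parent_forest => x_f /forallP U_f; exists f => //.
  rewrite in_set parent_mapsD1 ?in_setT // fP x_f; apply/forall_inP=> i.
  by rewrite inE -singleton_parent_forest; apply/implyP.
case=> f; rewrite in_set parent_mapsD1 ?in_setT // => /andP[/andP[fP x_f]].
move=> /forall_inP U_f ->; split; first exact: parent_forest_labeled.
  by rewrite singleton_parent_forest.
apply/forallP=> i; apply/implyP=> lt_mi.
by rewrite singleton_parent_forest U_f // inE.
Qed.

(** Block count first, as the recursion is on it; [k] is the number of elements outside the block of
    a distinguished element. *)
Fixpoint stirling (j n : nat) : nat :=
  match j, n with
  | 0, _ => (n == 0%N)
  | j'.+1, 0 => 0%N
  | j'.+1, n'.+1 => \sum_(k < n'.+1) 'C(n', k) * stirling j' k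
  end%N.

(* The elements outside the block of a fixed point x form a set D, on which the
   other blocks induce a partition. *)
Lemma card_partitions (T : finType) (S : {set T}) (j : nat) :
  #|[set P | partition P S & #|P| == j]| = stirling j #|S|.
Proof.
elim: j S => [|j IHj] S.
  rewrite /=; have [/cards0_eq ->|nS0] := eqVneq #|S| 0%N.
    apply/eqP/cards1P; exists set0; apply/setP=> P; rewrite !inE cards_eq0.
    by case: eqVneq => [->|]; rewrite ?andbF // partition_set0 eqxx.
  apply/eqP; rewrite cards_eq0 -subset0; apply/subsetP=> P.
  rewrite inE => /andP[/[swap] /eqP/cards0_eq -> /and3P[/eqP cS _ _]].
  by rewrite -cS /cover big_set0 cards0 in nS0.
have [S0|[x Sx]] := set_0Vmem S.
  rewrite S0 cards0 /=; apply/eqP; rewrite cards_eq0 -subset0.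
  apply/subsetP=> P; rewrite !inE partition_set0.
  by case/andP=> /eqP ->; rewrite cards0.
have Dn := cardsD1 x S; rewrite Sx add1n in Dn.
rewrite Dn /= -(sum_powerset_card (S :\ x)).
rewrite -sum1_card (partition_big (fun P => S :\: pblock P x)
                      [in powerset (S :\ x)]) => [|P] /=; last first.
  rewrite !inE => /andP[/and3P[/eqP cP tP _] _].
  by rewrite subsetD1 subsetDl inE mem_pblock cP Sx.
apply: eq_bigr => D; rewrite inE subsetD1 => /andP[sDS nDx].
rewrite -IHj sum1dep_card.
pose B := S :\: D.
have Bx : x \in B by rewrite inE nDx.
have BD : [disjoint B & D] by rewrite -setI_eq0 setIDAC setDIl setDv setI0.
have SBD : B :|: D = S.
  by rewrite /B setUC setDE setUIr setUCr setIT; apply/setUidPr.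
have nQB (Q : {set {set T}}) : partition Q D -> B \notin Q.
  case/and3P=> /eqP cQ _ _; apply: contra nDx => QB; rewrite -cQ.
  by apply/bigcupP; exists B.
(* Adding the block [B] of x matches the partitions of [D] with the partitions of [S] that have [B]
   as a block. *)
rewrite -[RHS](card_in_imset (f := fun Q : {set {set T}} => B |: Q));
  last first.
  move=> Q Q'; rewrite [Q \in _]in_set [Q' \in _]in_set.
  move=> /andP[/nQB QB _] /andP[/nQB QB' _] eqQ.
  by rewrite -(setU1K QB) eqQ setU1K.
apply: eq_card => P; rewrite !inE; apply/idP/imsetP.
  case/andP=> /andP[Pp cardP] /eqP DD.
  have /and3P[/eqP cP tP _] := Pp.
  have DB : pblock P x = B.
    rewrite /B -DD setDDr setDv set0U; apply/esym/setIidPr.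
    by rewrite -cP /cover (bigcup_max (pblock P x)) ?pblock_mem ?cP.
  have PB : B \in P by rewrite -DB pblock_mem ?cP.
  exists (P :\ B); last by rewrite setD1K.
  have := partitionD1 Pp PB.
  rewrite inE {2}/B setDDr setDv set0U (setIidPr sDS).
  by move=> ->; move: cardP; rewrite (cardsD1 B) PB add1n.
case=> Q; rewrite inE => /andP[Qp cardQ] ->.
have B0 : B != set0 by apply/set0Pn; exists x.
have := partitionU1 Qp B0 BD; rewrite SBD => Pp; rewrite Pp /=.
have /and3P[_ tP _] := Pp.
rewrite cardsU1 nQB // add1n eqSS cardQ /=.
rewrite (def_pblock tP _ Bx) ?setU11 // /B setDDr setDv set0U.
by apply/eqP/setIidPr.
Qed.

Lemma stirling2E (n j : nat) : stirling2 n j = stirling j n.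
Proof. by rewrite /stirling2 card_partitions cardsT card_ord. Qed.

Lemma stirling_small (j n : nat) : (n < j)%N -> stirling j n = 0%N.
Proof.
elim: j n => // j IHj [|n] //= lt_nj; rewrite big1 // => k _.
by rewrite IHj ?muln0 //; have := ltn_ord k; lia.
Qed.

(** Padding with zero coefficients gives all [bell_poly k] with k <= N one range of summation, so
    that sums can be exchanged. *)
Lemma bell_polyE (n N : nat) :
  (n <= N)%N -> bell_poly n = \sum_(j < N.+1) (stirling j n)%:R *: 'X^j.
Proof.
move=> le_nN; pose F j : {poly rat} := (stirling2 n j)%:R *: 'X^j.
rewrite /bell_poly (big_ord_widen N.+1 F) //.
rewrite big_mkcond; apply: eq_bigr => j _; rewrite /F stirling2E ltnS.
by case: leqP => // lt_nj; rewrite stirling_small ?scale0r.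
Qed.

Lemma bell_polyS (n : nat) :
  bell_poly n.+1 = 'X * bconv (fun=> 1) bell_poly n.
Proof.
rewrite (bell_polyE (leqnn _)) big_ord_recl /= scale0r add0r mulr_sumr.
(* The Stirling recursion counts elements outside the distinguished block, the convolution those
   inside. *)
rewrite [RHS](reindex_inj rev_ord_inj) /=.
transitivity (\sum_(k < n.+1) \sum_(j < n.+1)
                'X * ('C(n, k)%:R * ((stirling j k)%:R *: 'X^j)) : {poly rat}).
  rewrite exchange_big /=; apply: eq_bigr => j _.
  rewrite /bump /= add1n natr_sum scaler_suml; apply: eq_bigr => k _.
  by rewrite natrM exprS -scalerA scalerAr scaler_nat mulr_natl mulrnAr.
apply: eq_bigr => k _; rewrite subSS subKn ?mulr1; last by rewrite -ltnS.
rewrite bin_sub; last by rewrite -ltnS.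
by rewrite (@bell_polyE k n) -1?ltnS // -!mulr_sumr.
Qed.

(** The constant sequence is its own shift, so the Leibniz rule produces l(m, j + 1) + l(m, j),
    which is l(m + 1, j). *)
Lemma cayley_bconv (R : pzRingType) (m k : nat) :
  (cayley (m + k))%:R = bconv (nonsingleton_forests R m) (fun=> 1) k.
Proof.
elim: k m => [|k IHk] m; first by rewrite addn0 /bconv big_ord1 !mulr1 mul1r.
rewrite addnS -addSn IHk bconv_leibniz -bconvDl; apply: eq_bconv => // j.
by rewrite /= subrK.
Qed.

(* Subtraction on nat is truncated, so for m = k = 0 the factor
   (m + k + 1) ^ (m + k - 1) is 1 ^ 0 = 1, which agrees with 1^{-1} = 1. *)
Theorem theorem5p3 (n m : nat) :
  let y : {poly rat} := 'X in
  [/\ \sum_(k < n.+1) 'C(n, k)%:R * (L (m + k) m)%:R * (y + 1) ^+ (n - k)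
      = \sum_(k < n.+1) 'C(n, k)%:R
          * ((m + k + 1) ^ (m + k - 1))%N%:R * y ^+ (n - k),
      \sum_(k < n.+1) 'C(n, k)%:R * (L (m + k) m)%:R * bell_poly (n - k + 1)
      = y * \sum_(k < n.+1) 'C(n, k)%:R
          * ((m + k + 1) ^ (m + k - 1))%N%:R * bell_poly (n - k)
    & \sum_(k < n.+1) 'C(n, k)%:R * binom_poly (y + (n - k)%:R) (n - k)
          * (L (m + k) m)%:R
      = \sum_(k < n.+1) 'C(n, k)%:R * binom_poly y (n - k)
          * ((m + k + 1) ^ (m + k - 1))%N%:R].
Proof.
move=> y; pose l := nonsingleton_forests {poly rat} m.
have master (v w : nat -> {poly rat}) : v =1 bconv (fun=> 1) w ->
    \sum_(k < n.+1) 'C(n, k)%:R * (L (m + k) m)%:R * v (n - k)%N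
      = \sum_(k < n.+1) 'C(n, k)%:R
          * ((m + k + 1) ^ (m + k - 1))%N%:R * w (n - k)%N.
  move=> Dv; transitivity (bconv l v n).
    by apply: eq_bigr => k _; rewrite L_nonsingleton_forests.
  rewrite (eq_bconv (frefl l) Dv) -bconvA; apply: eq_bigr => k _.
  by rewrite -cayley_bconv.
split.
- apply: (master (fun j => (y + 1) ^+ j) (fun j => y ^+ j)) => j.
  rewrite exprDn; apply: eq_bigr => i _.
  by rewrite expr1n !mulr1 mulr_natl.
(* The weight B_{j+1}(y) / y enters without division, as the convolution of 1 with the Bell
   polynomials. *)
- rewrite -(master (bconv (fun=> 1) bell_poly)) // mulr_sumr.
  apply: eq_bigr => k _; by rewrite addn1 bell_polyS mulrCA.
rewrite -[LHS](eq_bigr _ (fun k _ => mulrAC _ _ _)).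
rewrite -[RHS](eq_bigr _ (fun k _ => mulrAC _ _ _)).
apply: (master (fun j => binom_poly (y + j%:R) j) (binom_poly y)) => j.
by rewrite binom_poly_vandermonde; apply: eq_bigr => i _; rewrite mulr1.
Qed.
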